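(* $\mathcal{W}^{\mathcal{N}=2}_\infty$ is a minimal $\mathcal{N}=2$ supersymmetric extension of either of its subalgebras $\mathcal{W}^+_\infty$ or $\mathcal{W}^-_\infty$.
   Context: If $\mathcal{A}$ is an $\mathcal{N}=2$ superconformal vertex algebra (a conformal extension of the $\mathcal{N}=2$ superconformal algebra $\mathrm{Vir}^c_{\mathcal{N}=2}$) and a vertex algebra $\mathcal{V}$ embeds in $\mathcal{A}$ (not necessarily conformally), $\mathcal{A}$ is called an $\mathcal{N}=2$ supersymmetric extension of $\mathcal{V}$. It is minimal if no proper $\mathcal{N}=2$ superconformal subalgebra of $\mathcal{A}$ is an $\mathcal{N}=2$ supersymmetric extension of $\mathcal{V}$ (via the given embedding). $\mathcal{W}^{\mathcal{N}=2}_\infty$ is the universal $2$-parameter vertex superalgebra over $R=\mathbb{C}[c,\lambda]$ localized at $c,c-1,c+3$, freely generated by $H,G^\pm,L$ (weights $1,\frac32,\frac32,2$) and $W^{N,\bot},W^{N,\pm},W^{N,\top}$, $N\ge2$ (weights $N,N+\frac12,N+\frac12,N+1$; fields with $\pm$ odd), with: $H,G^\pm,L$ generating $\mathrm{Vir}^c_{\mathcal{N}=2}$ ($H(z)H(w)\sim\frac{c/3}{(z-w)^2}$, $H(z)G^\pm(w)\sim\frac{\pm G^\pm(w)}{z-w}$, $G^+(z)G^-(w)\sim\frac{c/3}{(z-w)^3}+\frac{H(w)}{(z-w)^2}+\frac{(L+\frac12\partial H)(w)}{z-w}$, $L$ conformal); $H_{(0)}W^{N,\bot}=0$, $W^{N,\pm}=\mp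 G^\pm_{(0)}W^{N,\bot}$, $W^{N,\top}=\pm G^\pm_{(0)}G^\mp_{(0)}W^{N,\bot}\mp\frac12\partial W^{N,\bot}$; $W^{2,\bot}$ primary for $\mathrm{Vir}^c_{\mathcal{N}=2}$; $W^{2,\top}_{(1)}W^{N,\bot}=W^{N+1,\bot}$; an order-two automorphism $H\mapsto-H$, $G^\pm\mapsto G^\mp$, $L\mapsto L$, $W^{N,\bot}\mapsto(-1)^NW^{N,\bot}$, $W^{N,\pm}\mapsto(-1)^{N+1}W^{N,\mp}$, $W^{N,\top}\mapsto(-1)^{N+1}W^{N,\top}$; and $W^{2,\bot}(z)W^{2,\bot}(w)\sim\frac{\omega}{(z-w)^4}+\frac{(\frac{4\omega}{c-1}L-\frac{6\omega}{c(c-1)}:HH:+\lambda W^{2,\bot})(w)}{(z-w)^2}+\cdots$ ($\omega$ a scaling parameter). With $T=L-\frac{3}{2c}:HH:$ and $\gamma=\sqrt{\lambda^2+\frac{32\omega}{c-1}}$, the fields $L_\mp=\frac12T\pm\frac\lambda\gamma(\frac12T-\frac2\lambda W^{2,\bot})$ are commuting Virasoro fields (over the extension of the base ring by $\gamma$), and $\mathcal{W}^\pm_\infty$ are two commuting copies of the universal $2$-parameter algebra $\mathcal{W}_\infty$ of type $\mathcal{W}(2,3,\dots)$ with conformal vectors $L_\pm$, so that $\mathcal{W}^{\mathcal{N}=2}_\infty$ is a conformal extension of $\mathcal{H}\otimes\mathcal{W}^+_\infty\otimes\mathcal{W}^-_\infty$, $\mathcal{H}$ being the Heisenberg algebra generated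 by $H$. The subalgebra $\mathcal{W}_\infty^\pm$ is generated by $L_\pm$ and the (unique up to scaling) weight $3$ field primary for $L_\pm$ that commutes with $H$ and $L_\mp$. *)

(* Defs.v *)
From HB Require Import structures.
From mathcomp Require Import all_boot all_order all_algebra.
From mathcomp Require Import boolp reals complex.

Set Implicit Arguments.
Unset Strict Implicit.
Unset Printing Implicit Defensive.

Import Order.TTheory GRing.Theory Num.Theory.
Local Open Scope ring_scope.

(* Binomial coefficient m (m - 1) ... (m - j + 1) / j! for an integer m; for
   m = Negz n = - n - 1 it equals (-1)^j 'C(n + j, j). *)
Definition binz (m : int) (j : nat) : int :=
  match m with
  | Posz n => Posz 'C(n, j)
  | Negz n => (-1) ^+ j * Posz 'C(n + j, j)
  end.

Reserved Notation "a \_( n ) b"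
  (at level 30, n at level 99, right associativity, format "a  \_( n )  b").

(* The sums in the Borcherds identity have finitely many nonzero terms by the
   truncation axiom; the identity is stated for all large enough partial sums. *)
HB.mixin Record isVertexSuperalgebra (K : comNzRingType) V
    of GRing.Lmodule K V := {
  vac : V;
  nprod : V -> int -> V -> V;
  has_parity : bool -> V -> Prop;
  nprod_linearl : forall (n : int) (b : V), linear (fun a => nprod a n b);
  nprod_linearr : forall (a : V) (n : int), linear (nprod a n);
  has_parity_linear : forall p (k : K) (a b : V),
    has_parity p a -> has_parity p b -> has_parity p (k *: a + b);
  parity_decomp : forall a : V, exists a0 a1 : V,
    [/\ has_parity false a0, has_parity true a1 & a = a0 + a1];
  parity_direct : forall a : V,
    has_parity false a -> has_parity true a -> a = 0;
  vac_even : has_parity false vac;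
  nprod_parity : forall p q (a b : V) (n : int),
    has_parity p a -> has_parity q b -> has_parity (p (+) q) (nprod a n b);
  nprod_truncated : forall a b : V,
    exists N : nat, forall n : nat, (N <= n)%N -> nprod a n b = 0;
  vac_nprod : forall (n : int) (a : V),
    nprod vac n a = if n == -1 then a else 0;
  nprod_vacN1 : forall a : V, nprod a (-1) vac = a;
  nprod_vac_ge0 : forall (a : V) (n : nat), nprod a n vac = 0;
  borcherds : forall p q (a b x : V) (m n k : int),
    has_parity p a -> has_parity q b ->
    exists N0 : nat, forall N : nat, (N0 <= N)%N ->
      \sum_(j < N)
        nprod (nprod a (n + j%:Z) b) (m + k - j%:Z) x *~ binz m j =
      \sum_(j < N)
        (nprod a (m + n - j%:Z) (nprod b (k + j%:Z) x)
         - (-1) ^+ `|n|%N *: ((-1) ^+ (p && q)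
             *: nprod b (n + k - j%:Z) (nprod a (m + j%:Z) x)))
        *~ ((-1) ^+ j * binz n j)
}.

#[short(type="vsalgType")]
HB.structure Definition VertexSuperalgebra (K : comNzRingType) :=
  {V of isVertexSuperalgebra K V & GRing.Lmodule K V}.

Notation "a \_( n ) b" := (nprod a n b) : ring_scope.

Section Basics.
Context {K : comNzRingType} {A : vsalgType K}.

Definition translation (a : A) : A := a \_(-2) vac.

Definition normal_order (a b : A) : A := a \_(-1) b.

Definition commuting (a b : A) : Prop := forall n : nat, a \_(n) b = 0.

End Basics.

(* Morphism along a ring morphism j of the base rings; for vertex superalgebras
   over the same ring, j is the identity. *)
Record va_morphism {K K' : comNzRingType} (j : {rmorphism K -> K'})
    {A : vsalgType K} {A' : vsalgType K'} (f : A -> A') : Prop := VaMorphism {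
  va_morphD : forall a b, f (a + b) = f a + f b;
  va_morphZ : forall k a, f (k *: a) = j k *: f a;
  va_morph_vac : f vac = vac;
  va_morph_nprod : forall a n b, f (a \_(n) b) = f a \_(n) f b;
  va_morph_parity : forall p a, has_parity p a -> has_parity p (f a)
}.

Definition va_embedding {K : comNzRingType} {V A : vsalgType K} (f : V -> A) :=
  va_morphism (idfun : {rmorphism K -> K}) f /\ injective f.

Record subvsalg (K : comNzRingType) (A : vsalgType K) := SubVsalg {
  subvs_pred :> {pred A};
  subvs_submod : submod_closed subvs_pred;
  subvs_vac : vac \in subvs_pred;
  subvs_nprod : forall a n b,
    a \in subvs_pred -> b \in subvs_pred -> a \_(n) b \in subvs_pred;
  subvs_graded : forall a, a \in subvs_pred -> exists a0 a1,
    [/\ a0 \in subvs_pred, a1 \in subvs_pred,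
        has_parity false a0, has_parity true a1 & a = a0 + a1]
}.

HB.instance Definition _ (K : comNzRingType) (A : vsalgType K)
    (B : subvsalg A) :=
  GRing.isSubmodClosed.Build K A (subvs_pred B) (subvs_submod B).

Section SubVertexSuperalgebra.
Variables (K : comNzRingType) (A : vsalgType K) (B : subvsalg A).

Definition sub_va : Type := {x : A | x \in subvs_pred B}.
Definition sub_val (x : sub_va) : A := sval x.

HB.instance Definition _ := [isSub of sub_va for sub_val].
HB.instance Definition _ := [Choice of sub_va by <:].
HB.instance Definition _ := [SubChoice_isSubLmodule of sub_va by <:].


Fact sub_linearl (n : int) (b : sub_va) :
  linear (fun a : sub_va => exist _ (sub_val a \_(n) sub_val b)
    (subvs_nprod n (valP a) (valP b)) : sub_va).
Proof. by move=> k u v; apply: val_inj; rewrite /= nprod_linearl. Qed.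

Fact sub_linearr (a : sub_va) (n : int) :
  linear (fun b : sub_va => exist _ (sub_val a \_(n) sub_val b)
    (subvs_nprod n (valP a) (valP b)) : sub_va).
Proof. by move=> k u v; apply: val_inj; rewrite /= nprod_linearr. Qed.

Definition sub_vac : sub_va := exist _ vac (subvs_vac B).
Definition sub_nprod (a : sub_va) (n : int) (b : sub_va) : sub_va :=
  exist _ (sub_val a \_(n) sub_val b) (subvs_nprod n (valP a) (valP b)).
Definition sub_parity p (a : sub_va) : Prop := has_parity p (sub_val a).

Fact sub_parity_linear p (k : K) (a b : sub_va) :
  sub_parity p a -> sub_parity p b -> sub_parity p (k *: a + b).
Proof. exact: has_parity_linear. Qed.

Fact sub_parity_decomp (a : sub_va) : exists a0 a1 : sub_va,
  [/\ sub_parity false a0, sub_parity true a1 & a = a0 + a1].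
Proof.
have [a0 [a1 [Ba0 Ba1 p0 p1 Da]]] := subvs_graded (valP a).
exists (exist _ a0 Ba0), (exist _ a1 Ba1); split=> //.
exact: val_inj.
Qed.

Fact sub_parity_direct (a : sub_va) :
  sub_parity false a -> sub_parity true a -> a = 0.
Proof. by move=> p0 p1; apply: val_inj; apply: parity_direct. Qed.

Fact sub_vac_even : sub_parity false sub_vac.
Proof. exact: vac_even. Qed.

Fact sub_nprod_parity p q (a b : sub_va) (n : int) :
  sub_parity p a -> sub_parity q b -> sub_parity (p (+) q) (sub_nprod a n b).
Proof. exact: nprod_parity. Qed.

Fact sub_truncated (a b : sub_va) :
  exists N : nat, forall n : nat, (N <= n)%N -> sub_nprod a n b = 0.
Proof.
have [N HN] := nprod_truncated (sub_val a) (sub_val b).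
by exists N => n /HN ab0; apply: val_inj.
Qed.

Fact sub_vac_nprod (n : int) (a : sub_va) :
  sub_nprod sub_vac n a = if n == -1 then a else 0.
Proof.
by apply: val_inj; rewrite [LHS](vac_nprod n (sub_val a)); case: ifP.
Qed.

Fact sub_nprod_vacN1 (a : sub_va) : sub_nprod a (-1) sub_vac = a.
Proof. apply: val_inj; exact: nprod_vacN1. Qed.

Fact sub_nprod_vac_ge0 (a : sub_va) (n : nat) : sub_nprod a n sub_vac = 0.
Proof. apply: val_inj; exact: nprod_vac_ge0. Qed.

Fact sub_borcherds p q (a b x : sub_va) (m n k : int) :
  sub_parity p a -> sub_parity q b ->
  exists N0 : nat, forall N : nat, (N0 <= N)%N ->
    \sum_(j < N)
      sub_nprod (sub_nprod a (n + j%:Z) b) (m + k - j%:Z) x *~ binz m j =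
    \sum_(j < N)
      (sub_nprod a (m + n - j%:Z) (sub_nprod b (k + j%:Z) x)
       - (-1) ^+ `|n|%N *: ((-1) ^+ (p && q)
           *: sub_nprod b (n + k - j%:Z) (sub_nprod a (m + j%:Z) x)))
      *~ ((-1) ^+ j * binz n j).
Proof.
move=> pa qb; have [N0 HN] := borcherds p q (sub_val a) (sub_val b) (sub_val x) m n k pa qb.
have valMz (u : sub_va) z : val (u *~ z) = val u *~ z by rewrite raddfMz.
exists N0 => N /HN E; apply: val_inj; rewrite !raddf_sum.
apply: etrans (etrans E _); apply: eq_bigr => i _; first exact: valMz.
by symmetry; apply: valMz.
Qed.

HB.instance Definition _ := isVertexSuperalgebra.Build K sub_va
  sub_linearl sub_linearr sub_parity_linear sub_parity_decomp
  sub_parity_direct sub_vac_even sub_nprod_parity sub_truncated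
  sub_vac_nprod sub_nprod_vacN1 sub_nprod_vac_ge0 sub_borcherds.

End SubVertexSuperalgebra.

Arguments sub_val {K A B} x.

Section GeneratedSubalgebra.
Variables (K : comNzRingType) (A : vsalgType K) (X : A -> Prop).

Definition gen_pred : {pred A} := fun a =>
  `[< forall B : subvsalg A, (forall x, X x -> x \in subvs_pred B) ->
      a \in subvs_pred B >].

Fact gen_predP a : reflect (forall B : subvsalg A,
  (forall x, X x -> x \in subvs_pred B) -> a \in subvs_pred B) (a \in gen_pred).
Proof. exact: asboolP. Qed.

Fact gen_submod : submod_closed gen_pred.
Proof.
split=> [|k u v /gen_predP Gu /gen_predP Gv]; apply/gen_predP => B XB.
  exact: rpred0.
by rewrite rpredD ?rpredZ ?Gu ?Gv.
Qed.

Fact gen_vac : vac \in gen_pred.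
Proof. by apply/gen_predP => B _; apply: subvs_vac. Qed.

Fact gen_nprod a n b :
  a \in gen_pred -> b \in gen_pred -> a \_(n) b \in gen_pred.
Proof.
move=> /gen_predP Ga /gen_predP Gb; apply/gen_predP => B XB.
exact: subvs_nprod (Ga B XB) (Gb B XB).
Qed.

Fact gen_graded a : a \in gen_pred -> exists a0 a1,
  [/\ a0 \in gen_pred, a1 \in gen_pred,
      has_parity false a0, has_parity true a1 & a = a0 + a1].
Proof.
move=> /gen_predP Ga; have [a0 [a1 [p0 p1 Da]]] := parity_decomp a.
have parN p (u v : A) : has_parity p u -> has_parity p v -> has_parity p (u - v).
  by move=> pu pv; rewrite addrC -scaleN1r; apply: has_parity_linear.
suff G01 (B : subvsalg A) : (forall x, X x -> x \in subvs_pred B) ->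
    a0 \in subvs_pred B /\ a1 \in subvs_pred B.
  by exists a0, a1; split=> //; apply/gen_predP => B /G01[].
move=> /Ga /subvs_graded[b0 [b1 [Bb0 Bb1 q0 q1 Db]]].
have E : a0 - b0 = b1 - a1.
  by apply/eqP; rewrite subr_eq addrAC [b1 + b0]addrC -Db Da addrK.
have E0 : a0 - b0 = 0 by apply: parity_direct; [|rewrite E]; apply: parN.
have /eqP := E0; rewrite subr_eq0 => /eqP ->; split=> //.
by move: E; rewrite E0 => /esym/eqP; rewrite subr_eq0 => /eqP <-.
Qed.

Definition generated_subalgebra : subvsalg A :=
  SubVsalg gen_submod gen_vac gen_nprod gen_graded.

End GeneratedSubalgebra.

(* Families e are indexed by the elements of I satisfying D. *)
Section Bases.
Context {K : comNzRingType} {V : lmodType K} {I : eqType}.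
Implicit Types (D : pred I) (e : I -> V).

Definition free_on D e : Prop := forall (s : seq I) (k : I -> K),
  uniq s -> all D s -> \sum_(i <- s) k i *: e i = 0 ->
  forall i, i \in s -> k i = 0.

Definition spanning_on D e : Prop := forall v : V,
  exists (s : seq I) (k : I -> K),
    all D s /\ v = \sum_(i <- s) k i *: e i.

Definition basis_on D e : Prop := free_on D e /\ spanning_on D e.

End Bases.

Section FreeGeneration.
Context {K : comNzRingType} {A : vsalgType K} {d : Order.disp_t}
  {I : orderType d}.
Variables (odd_gen : pred I) (gen : I -> A).

(* The letter (i, n) stands for gen i \_(- n - 1), i.e. for the field
   (1 / n!) d^n (gen i); a letter of an odd generator may not be repeated. *)
Definition pbw_rel (x y : I * nat) : bool :=
  (x.1 < y.1)%O
  || (x.1 == y.1) && (if odd_gen x.1 then x.2 < y.2 else x.2 <= y.2)%N.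

Definition pbw_word : pred (seq (I * nat)) := sorted pbw_rel.

Definition pbw_monomial (s : seq (I * nat)) : A :=
  foldr (fun x a => gen x.1 \_(Negz x.2) a) vac s.

Definition freely_generate_subalgebra : Prop := free_on pbw_word pbw_monomial.

Definition freely_generated : Prop := basis_on pbw_word pbw_monomial.

End FreeGeneration.

(* A' is the extension of scalars of A along j, with a |-> 1 (x) a = f a.  The
   condition on bases characterizes it as soon as A is a free K-module. *)
Definition scalar_extension {K K' : comNzRingType} (j : {rmorphism K -> K'})
    {A : vsalgType K} {A' : vsalgType K'} (f : A -> A') : Prop :=
  va_morphism j f /\
  forall (I : eqType) (D : pred I) (e : I -> A),
    basis_on D e -> basis_on D (f \o e).

Section Superconformal.
Context {K : comUnitRingType} {A : vsalgType K}.

Record virasoro (c : K) (L : A) : Prop := Virasoro {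
  vir_even : has_parity false L;
  vir0 : L \_(0) L = translation L;
  vir1 : L \_(1) L = 2%:R *: L;
  vir2 : L \_(2) L = 0;
  vir3 : L \_(3) L = (c / 2%:R) *: vac;
  vir_ge4 : forall n : nat, (4 <= n)%N -> L \_(n) L = 0
}.

Record conformal (c : K) (L : A) : Prop := Conformal {
  conf_virasoro : virasoro c L;
  conf_translation : forall a, L \_(0) a = translation a;
  conf_diag : forall a, exists s : seq (K * A),
    (forall x, x \in s -> L \_(1) x.2 = x.1 *: x.2)
    /\ a = \sum_(x <- s) x.2
}.

Record primary (L : A) (h : K) (a : A) : Prop := Primary {
  prim0 : L \_(0) a = translation a;
  prim1 : L \_(1) a = h *: a;
  prim_ge2 : forall n : nat, (2 <= n)%N -> L \_(n) a = 0
}.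

Record n2_fields := N2Fields { fH : A; fGp : A; fGm : A; fL : A }.

Definition n2_gen (N : n2_fields) (i : 'I_4) : A :=
  nth 0 [:: fH N; fGp N; fGm N; fL N] i.

(* Second and third generators of a quadruple of weights h, h+1/2, h+1/2, h+1 *)
Definition odd4 (i : 'I_4) : bool := (i == 1%N :> nat) || (i == 2%N :> nat).

(* A is a conformal extension of the N = 2 superconformal algebra of central
   charge c; n2_free says that the fields generate a copy of the universal one
   rather than of a proper quotient. *)
Record n2_superconformal (c : K) (N : n2_fields) : Prop := N2Superconformal {
  n2_L : conformal c (fL N);
  n2_H_even : has_parity false (fH N);
  n2_Gp_odd : has_parity true (fGp N);
  n2_Gm_odd : has_parity true (fGm N);
  n2_H_primary : primary (fL N) 1 (fH N);
  n2_Gp_primary : primary (fL N) (3%:R / 2%:R) (fGp N);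
  n2_Gm_primary : primary (fL N) (3%:R / 2%:R) (fGm N);
  n2_HH0 : fH N \_(0) fH N = 0;
  n2_HH1 : fH N \_(1) fH N = (c / 3%:R) *: vac;
  n2_HH_ge2 : forall n : nat, (2 <= n)%N -> fH N \_(n) fH N = 0;
  n2_HGp0 : fH N \_(0) fGp N = fGp N;
  n2_HGm0 : fH N \_(0) fGm N = - fGm N;
  n2_HGp_ge1 : forall n : nat, (1 <= n)%N -> fH N \_(n) fGp N = 0;
  n2_HGm_ge1 : forall n : nat, (1 <= n)%N -> fH N \_(n) fGm N = 0;
  n2_GpGp : commuting (fGp N) (fGp N);
  n2_GmGm : commuting (fGm N) (fGm N);
  n2_GpGm0 :
    fGp N \_(0) fGm N = fL N + (2%:R)^-1 *: translation (fH N);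
  n2_GpGm1 : fGp N \_(1) fGm N = fH N;
  n2_GpGm2 : fGp N \_(2) fGm N = (c / 3%:R) *: vac;
  n2_GpGm_ge3 : forall n : nat, (3 <= n)%N -> fGp N \_(n) fGm N = 0;
  n2_free : freely_generate_subalgebra odd4 (n2_gen N)
}.

(* Primary of conformal weight h and H-charge 0 *)
Record n2_primary (N : n2_fields) (h : K) (a : A) : Prop := N2Primary {
  n2p_L : primary (fL N) h a;
  n2p_H : commuting (fH N) a;
  n2p_Gp : forall n : nat, (1 <= n)%N -> fGp N \_(n) a = 0;
  n2p_Gm : forall n : nat, (1 <= n)%N -> fGm N \_(n) a = 0
}.

End Superconformal.

Arguments n2_fields {K} A.

Definition map_n2_fields {K K' : comUnitRingType} {A : vsalgType K}
    {A' : vsalgType K'} (f : A -> A') (N : n2_fields A) : n2_fields A' :=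
  N2Fields (f (fH N)) (f (fGp N)) (f (fGm N)) (f (fL N)).

Section Extensions.
Context {K : comUnitRingType} {V A : vsalgType K}.

Definition n2_extension (c : K) (N : n2_fields A) (f : V -> A) : Prop :=
  n2_superconformal c N /\ va_embedding f.

End Extensions.

(* An N = 2 superconformal subalgebra B of A carries the N = 2 structure of A;
   it is an extension of V via f if f factors through B. *)
Definition minimal_n2_extension {K : comUnitRingType} {V A : vsalgType K}
    (c : K) (N : n2_fields A) (f : V -> A) : Prop :=
  n2_extension c N f /\
  forall (B : subvsalg A) (NB : n2_fields (sub_va B)) (g : V -> sub_va B),
    map_n2_fields sub_val NB = N ->
    n2_extension c NB g ->
    (forall v, sub_val (g v) = f v) ->
    forall a, a \in subvs_pred B.

(* wb M, wp M, wm M, wt M are W^{M,bot}, W^{M,+}, W^{M,-}, W^{M,top}; only the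
   indices M >= 2 are meaningful. *)
Record w_fields {K : comUnitRingType} (A : vsalgType K) := WFields {
  wN2 :> n2_fields A; wb : nat -> A; wp : nat -> A; wm : nat -> A; wt : nat -> A
}.

Section UniversalAlgebra.
Context {K : comUnitRingType} {A : vsalgType K}.

(* The four fields of index M = n + 1, with H, G^+, G^-, L for M = 1 *)
Definition w_gen (W : w_fields A) (x : nat *l 'I_4) : A :=
  if x.1 is 0%N then n2_gen W x.2
  else nth 0 [:: wb W x.1.+1; wp W x.1.+1; wm W x.1.+1; wt W x.1.+1] x.2.

Record is_w_n2_infty (c lambda omega : K) (W : w_fields A) : Prop := IsWN2 {
  w_n2 : n2_superconformal c W;
  w_free : freely_generated (fun x : nat *l 'I_4 => odd4 x.2) (w_gen W);
  w_bot_even : forall M, (2 <= M)%N -> has_parity false (wb W M);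
  w_plus_odd : forall M, (2 <= M)%N -> has_parity true (wp W M);
  w_minus_odd : forall M, (2 <= M)%N -> has_parity true (wm W M);
  w_top_even : forall M, (2 <= M)%N -> has_parity false (wt W M);
  w_bot_weight : forall M, (2 <= M)%N ->
    fL W \_(1) wb W M = M%:R *: wb W M;
  w_plus_weight : forall M, (2 <= M)%N ->
    fL W \_(1) wp W M = (M%:R + (2%:R)^-1) *: wp W M;
  w_minus_weight : forall M, (2 <= M)%N ->
    fL W \_(1) wm W M = (M%:R + (2%:R)^-1) *: wm W M;
  w_top_weight : forall M, (2 <= M)%N ->
    fL W \_(1) wt W M = (M%:R + 1) *: wt W M;
  w_charge : forall M, (2 <= M)%N -> fH W \_(0) wb W M = 0;
  w_plusE : forall M, (2 <= M)%N -> wp W M = - (fGp W \_(0) wb W M);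
  w_minusE : forall M, (2 <= M)%N -> wm W M = fGm W \_(0) wb W M;
  w_topE : forall M, (2 <= M)%N ->
    wt W M = fGp W \_(0) fGm W \_(0) wb W M
             - (2%:R)^-1 *: translation (wb W M);
  w_topE' : forall M, (2 <= M)%N ->
    wt W M = - (fGm W \_(0) fGp W \_(0) wb W M)
             + (2%:R)^-1 *: translation (wb W M);
  w_primary : n2_primary W 2%:R (wb W 2);
  w_raise : forall M, (2 <= M)%N -> wt W 2 \_(1) wb W M = wb W M.+1;
  w_automorphism : exists2 theta : A -> A,
    va_morphism (idfun : {rmorphism K -> K}) theta /\ involutive theta &
    [/\ theta (fH W) = - fH W, theta (fGp W) = fGm W,
        theta (fGm W) = fGp W, theta (fL W) = fL W &
        forall M, (2 <= M)%N ->
          [/\ theta (wb W M) = (-1) ^+ M *: wb W M,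
              theta (wp W M) = (-1) ^+ M.+1 *: wm W M,
              theta (wm W M) = (-1) ^+ M.+1 *: wp W M &
              theta (wt W M) = (-1) ^+ M.+1 *: wt W M]];
  w_ww1 : wb W 2 \_(1) wb W 2 =
    (4%:R * omega / (c - 1)) *: fL W
    - (6%:R * omega / (c * (c - 1))) *: normal_order (fH W) (fH W)
    + lambda *: wb W 2;
  w_ww2 : wb W 2 \_(2) wb W 2 = 0;
  w_ww3 : wb W 2 \_(3) wb W 2 = omega *: vac;
  w_ww_ge4 : forall n : nat, (4 <= n)%N -> wb W 2 \_(n) wb W 2 = 0
}.

Definition w_T (c : K) (W : w_fields A) : A :=
  fL W - (3%:R / (2%:R * c)) *: normal_order (fH W) (fH W).

(* (lambda / gamma) (T / 2 - (2 / lambda) W^{2,bot}), with lambda cleared *)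
Definition w_D (c lambda gamma : K) (W : w_fields A) : A :=
  (lambda / (2%:R * gamma)) *: w_T c W - (2%:R / gamma) *: wb W 2.

Definition w_Lplus (c lambda gamma : K) (W : w_fields A) : A :=
  (2%:R)^-1 *: w_T c W - w_D c lambda gamma W.

Definition w_Lminus (c lambda gamma : K) (W : w_fields A) : A :=
  (2%:R)^-1 *: w_T c W + w_D c lambda gamma W.

(* In W^{N=2}_infty such a w is unique up to scaling; any nonzero choice is
   allowed. *)
Record weight3_generator (H L1 L2 w : A) : Prop := Weight3 {
  w3_neq0 : w <> 0;
  w3_primary : primary L1 3%:R w;
  w3_H : commuting H w;
  w3_L2 : commuting L2 w
}.

Definition w_infty_sub (L1 w : A) : subvsalg A :=
  generated_subalgebra (fun x => x = L1 \/ x = w).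

End UniversalAlgebra.

Definition map_w_fields {K K' : comUnitRingType} {A : vsalgType K}
    {A' : vsalgType K'} (f : A -> A') (W : w_fields A) : w_fields A' :=
  WFields (map_n2_fields f W) (f \o wb W) (f \o wp W) (f \o wm W) (f \o wt W).

Definition complex_poly2 (Re : realType) : comNzRingType := {poly {poly Re[i]}}.

Definition var_c (Re : realType) : complex_poly2 Re := ('X : {poly Re[i]})%:P.
Definition var_lambda (Re : realType) : complex_poly2 Re := 'X.

(* iota : P -> R is the localization of P at the multiplicative set generated
   by the elements of s. *)
Definition is_localization {P : comNzRingType} {R : comUnitRingType}
    (s : seq P) (iota : {rmorphism P -> R}) : Prop :=
  let S (q : P) := exists m : nat -> nat, q = \prod_(i < size s) s`_i ^+ m i in
  [/\ forall q, S q -> iota q \is a GRing.unit,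
      forall r, exists p q, S q /\ r * iota q = iota p &
      forall p, iota p = 0 -> exists2 q, S q & q * p = 0].

(* j : R -> R' is the localization at gamma of R[gamma] / (gamma ^ 2 - x). *)
Definition is_sqrt_extension {R R' : comUnitRingType}
    (j : {rmorphism R -> R'}) (x : R) (gamma : R') : Prop :=
  [/\ gamma ^+ 2 = j x, gamma \is a GRing.unit,
      forall r, exists (n : nat) (a b : R),
        r * gamma ^+ n = j a + j b * gamma &
      forall a b : R, j a + j b * gamma = 0 -> a = 0 /\ b = 0].

(* Main.v *)
Require Import Defs.
From mathcomp Require Import all_boot all_order all_algebra.
From mathcomp Require Import boolp reals complex.
Import Order.TTheory GRing.Theory Num.Theory.
Local Open Scope ring_scope.

(** A subalgebra containing [H], [G^+], [G^-], [L] and [L_+] (or [L_-]) contains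
    [W^{2,bot}], because the coefficient [2 / gamma] of [W^{2,bot}] in [L_+] is
    invertible.  It is then closed under the recursion
    [W^{N+1,bot} = W^{2,top}_(1) W^{N,bot}] and under the formulas giving the other
    generators in terms of [G^+], [G^-] and [W^{N,bot}], so it contains all strong
    generators and hence everything.  That [W^{N=2}_infty] stays an N = 2
    superconformal vertex algebra after adjoining [gamma] is seen on the PBW basis. *)

(** The complex numbers have characteristic 0, so the constant polynomial [n] already has an
    inverse, which [iota] carries to [R]. *)
Lemma natr_unit_complex_poly2 {Re : realType} {R : comUnitRingType}
    (iota : {rmorphism complex_poly2 Re -> R}) {n : nat} :
  (0 < n)%N -> (n%:R : R) \is a GRing.unit.
Proof.
move=> n_gt0; apply/unitrPr; exists (iota ((n%:R^-1)%:P)%:P).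
rewrite -(rmorph_nat iota) -rmorphM -[n%:R]polyC_natr -polyC_natr -!polyCM.
by rewrite divff ?rmorph1 // pnatr_eq0 -lt0n.
Qed.

(** A linear relation among the [e'] becomes, reindexed along the injection [g], a relation among
    the [e] with the same coefficients. *)
Lemma free_on_comp {K : comNzRingType} {V : lmodType K} {I J : eqType}
    {D : pred I} {D' : pred J} {e : I -> V} {e' : J -> V} (g : J -> I) :
  injective g -> (forall x, D' x -> D (g x)) -> (forall x, e' x = e (g x)) ->
  free_on D e -> free_on D' e'.
Proof.
move=> gI Dg eg freeD s k us Ds sum0 x xs.
(* Looking up positions in [s] replaces an inverse of [g]; outside the image of [s] the default
   value is 0. *)
pose kg i := [seq k y | y <- s]`_(index i [seq g y | y <- s]).
have kgE y : y \in s -> kg (g y) = k y.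
  by move=> ys; rewrite /kg index_map // (nth_map y) ?index_mem // nth_index.
rewrite -kgE //; apply: (freeD [seq g y | y <- s] kg).
- by rewrite map_inj_uniq.
- by rewrite all_map; apply: sub_all Ds => y /Dg.
- rewrite big_map -[RHS]sum0 !big_seq; apply: eq_bigr => y ys.
  by rewrite kgE // eg.
by rewrite map_f.
Qed.

(** * Morphisms along a change of base ring *)

Section VaMorphism.
Context {K K' : comNzRingType} {j : {rmorphism K -> K'}}.
Context {A : vsalgType K} {A' : vsalgType K'} {f : A -> A'}.
Hypothesis fM : va_morphism j f.

Lemma va_morph0 : f 0 = 0.
Proof. by apply: (addrI (f 0)); rewrite -(va_morphD fM) !addr0. Qed.

Lemma va_morphN a : f (- a) = - f a.
Proof. by rewrite -scaleN1r (va_morphZ fM) rmorphN1 scaleN1r. Qed.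

Lemma va_morphB a b : f (a - b) = f a - f b.
Proof. by rewrite (va_morphD fM) va_morphN. Qed.

Lemma va_morph_sum {I : Type} (s : seq I) (F : I -> A) :
  f (\sum_(i <- s) F i) = \sum_(i <- s) f (F i).
Proof. exact: (big_morph f (va_morphD fM) va_morph0). Qed.

Lemma va_morph_translation a : f (translation a) = translation (f a).
Proof. by rewrite /translation (va_morph_nprod fM) (va_morph_vac fM). Qed.

Lemma va_morph_commuting a b : commuting a b -> commuting (f a) (f b).
Proof. by move=> C n; rewrite -(va_morph_nprod fM) C va_morph0. Qed.

Lemma va_morph_pbw_monomial {d : Order.disp_t} {I : orderType d} (gen : I -> A)
    (s : seq (I * nat)) :
  f (pbw_monomial gen s) = pbw_monomial (f \o gen) s.
Proof.
elim: s => [|x s IHs] /=; first exact: va_morph_vac fM.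
by rewrite (va_morph_nprod fM) IHs.
Qed.

(** Scalar extension need not be surjective; this weaker form of density is what lets linear
    statements pass from [A] to all of [A']. *)
Lemma va_morph_spanning {I : eqType} {D : pred I} {e : I -> A} :
  spanning_on D (f \o e) ->
  forall v : A', exists s : seq (K' * A), v = \sum_(x <- s) x.1 *: f x.2.
Proof.
move=> span v; have [s [k [_ ->]]] := span v.
by exists [seq (k i, e i) | i <- s]; rewrite big_map.
Qed.

End VaMorphism.

Lemma nprod0r {K : comNzRingType} {A : vsalgType K} (a : A) n : a \_(n) 0 = 0.
Proof.
by have := nprod_linearr a n (-1) 0 0; rewrite scaler0 addr0 scaleN1r addNr.
Qed.

Lemma nprodZr {K : comNzRingType} {A : vsalgType K} (a : A) n k b :
  a \_(n) (k *: b) = k *: a \_(n) b.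
Proof. by have := nprod_linearr a n k b 0; rewrite nprod0r !addr0. Qed.

Lemma nprodDr {K : comNzRingType} {A : vsalgType K} (a : A) n b b' :
  a \_(n) (b + b') = a \_(n) b + a \_(n) b'.
Proof. by have := nprod_linearr a n 1 b b'; rewrite !scale1r. Qed.

Lemma nprod_sumr {K : comNzRingType} {A : vsalgType K} {I : Type} (a : A) n
    (s : seq I) (F : I -> A) :
  a \_(n) (\sum_(i <- s) F i) = \sum_(i <- s) a \_(n) F i.
Proof. exact: (big_morph _ (nprodDr a n) (nprod0r a n)). Qed.

Lemma translation_sum {K : comNzRingType} {A : vsalgType K} {I : Type}
    (s : seq I) (k : I -> K) (F : I -> A) :
  translation (\sum_(i <- s) k i *: F i) = \sum_(i <- s) k i *: translation (F i).
Proof.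
rewrite /translation; elim: s => [|i s IHs].
  rewrite !big_nil; have := nprod_linearl (-2) (vac : A) (-1) 0 0.
  by rewrite scaler0 addr0 scaleN1r addNr.
by rewrite !big_cons nprod_linearl IHs.
Qed.

(** * Transfer of the N = 2 structure to the extended scalars *)

Section Transfer.
Context {K K' : comUnitRingType} {j : {rmorphism K -> K'}}.
Context {A : vsalgType K} {A' : vsalgType K'} {f : A -> A'}.
Hypothesis fM : va_morphism j f.
Hypothesis u2 : (2%:R : K) \is a GRing.unit.
Hypothesis u3 : (3%:R : K) \is a GRing.unit.

Lemma va_morph_virasoro c L : virasoro c L -> virasoro (j c) (f L).
Proof.
case=> p0 e0 e1 e2 e3 e4; split; first exact: va_morph_parity fM _ _ p0.
- by rewrite -(va_morph_nprod fM) e0 (va_morph_translation fM).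
- by rewrite -(va_morph_nprod fM) e1 (va_morphZ fM) rmorph_nat.
- by rewrite -(va_morph_nprod fM) e2 (va_morph0 fM).
- rewrite -(va_morph_nprod fM) e3 (va_morphZ fM) (va_morph_vac fM).
  by rewrite rmorphM rmorphV ?rmorph_nat.
by move=> n /e4 E; rewrite -(va_morph_nprod fM) E (va_morph0 fM).
Qed.

Lemma va_morph_primary L h a : primary L h a -> primary (f L) (j h) (f a).
Proof.
case=> e0 e1 e2; split.
- by rewrite -(va_morph_nprod fM) e0 (va_morph_translation fM).
- by rewrite -(va_morph_nprod fM) e1 (va_morphZ fM).
by move=> n /e2 E; rewrite -(va_morph_nprod fM) E (va_morph0 fM).
Qed.

(** Two clauses quantify over all of [A']. The action of [L_(0)] is linear, and a sum of vectors
    that decompose into [L_(1)]-eigenvectors decomposes too, so both reduce to the image of [f]. *)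
Lemma va_morph_conformal c L :
  (forall v : A', exists s : seq (K' * A), v = \sum_(x <- s) x.1 *: f x.2) ->
  conformal c L -> conformal (j c) (f L).
Proof.
move=> span [vL tL dL]; split; first exact: va_morph_virasoro.
  move=> a; have [s ->] := span a.
  rewrite nprod_sumr translation_sum; apply: eq_bigr => x _.
  by rewrite nprodZr -(va_morph_nprod fM) tL (va_morph_translation fM).
move=> a; have [s ->] := span a; elim: s => [|x s [t [tE sE]]].
  by exists [::]; rewrite !big_nil.
have [r [rE xE]] := dL x.2.
(* Scaling by [x.1] keeps an eigenvector an eigenvector; only the eigenvalue has to be moved along
   [j]. *)
exists ([seq (j y.1, x.1 *: f y.2) | y <- r] ++ t); split.
  move=> z; rewrite mem_cat => /orP[/mapP[y yr ->]|/tE//].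
  rewrite /= nprodZr -(va_morph_nprod fM) (rE _ yr) (va_morphZ fM).
  by rewrite !scalerA mulrC.
by rewrite big_cons sE big_cat big_map /= -scaler_sumr -(va_morph_sum fM) -xE.
Qed.

(** Applying [f] carries over the operator products. Freeness is not preserved by a general
    morphism, hence it is assumed for the image. *)
Lemma va_morph_n2_superconformal c N :
  (forall v : A', exists s : seq (K' * A), v = \sum_(x <- s) x.1 *: f x.2) ->
  freely_generate_subalgebra odd4 (n2_gen (map_n2_fields f N)) ->
  n2_superconformal c N -> n2_superconformal (j c) (map_n2_fields f N).
Proof.
move=> span free_fN hN; have fP := va_morph_nprod fM.
have j3 : j (c / 3%:R) = j c / 3%:R by rewrite rmorphM rmorphV ?rmorph_nat.
have j32 : j (3%:R / 2%:R) = 3%:R / 2%:R by rewrite rmorphM rmorphV ?rmorph_nat.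
have j2 : j (2%:R)^-1 = (2%:R)^-1 by rewrite rmorphV ?rmorph_nat.
case: hN => hL pH pGp pGm prH prGp prGm HH0 HH1 HH2 HGp0 HGm0 HGp1 HGm1 GpGp GmGm
  GG0 GG1 GG2 GG3 _.
split=> //=; try exact: (va_morph_commuting fM); try exact: (va_morph_parity fM).
- exact: va_morph_conformal.
- by rewrite -(rmorph1 j); apply: va_morph_primary.
- by rewrite -j32; apply: va_morph_primary.
- by rewrite -j32; apply: va_morph_primary.
- by rewrite -fP HH0 (va_morph0 fM).
- by rewrite -fP HH1 (va_morphZ fM) (va_morph_vac fM) j3.
- by move=> n /HH2 E; rewrite -fP E (va_morph0 fM).
- by rewrite -fP HGp0.
- by rewrite -fP HGm0 (va_morphN fM).
- by move=> n /HGp1 E; rewrite -fP E (va_morph0 fM).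
- by move=> n /HGm1 E; rewrite -fP E (va_morph0 fM).
- by rewrite -fP GG0 (va_morphD fM) (va_morphZ fM) (va_morph_translation fM) j2.
- by rewrite -fP GG1.
- by rewrite -fP GG2 (va_morphZ fM) (va_morph_vac fM) j3.
by move=> n /GG3 E; rewrite -fP E (va_morph0 fM).
Qed.

End Transfer.

(** PBW words in [H], [G^+], [G^-], [L] are words in all generators whose letters have first index
    0, where the lexicographic order restricts to that of ['I_4]. *)
Lemma w_gen_free_n2_gen {K : comUnitRingType} {A : vsalgType K} {W : w_fields A} :
  freely_generate_subalgebra (fun x : nat *l 'I_4 => odd4 x.2) (w_gen W) ->
  freely_generate_subalgebra odd4 (n2_gen W).
Proof.
pose g (x : 'I_4 * nat) : (nat *l 'I_4) * nat := ((0%N, x.1) : nat *l 'I_4, x.2).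
have gI : injective g by move=> [i m] [i' m'] [-> ->].
apply: (free_on_comp (map g)) => [|s|s].
- exact: inj_map.
- rewrite /pbw_word sorted_map; apply: sub_sorted => x y.
  by rewrite /pbw_rel /= ltEprodlexi.
by elim: s => //= x s ->.
Qed.

Lemma w_generators_mem_full {K : comUnitRingType} {A : vsalgType K}
    (B : subvsalg A) {W : w_fields A} :
  spanning_on (pbw_word (fun x : nat *l 'I_4 => odd4 x.2))
    (pbw_monomial (w_gen W)) ->
  (forall x, w_gen W x \in subvs_pred B) -> forall a, a \in subvs_pred B.
Proof.
move=> span WB a; have [s [k [_ ->]]] := span a.
apply: rpred_sum => i _; apply: rpredZ; elim: i => [|x i IHi] /=.
  exact: subvs_vac.
exact: subvs_nprod.
Qed.

(** * Recovering the strong generators inside a subalgebra *)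

Section GeneratorsInSubalgebra.
Context {K : comUnitRingType} {A : vsalgType K} {B : subvsalg A}.

Lemma subvs_translation a :
  a \in subvs_pred B -> translation a \in subvs_pred B.
Proof. by move=> Ba; apply: subvs_nprod; last exact: subvs_vac. Qed.

Lemma w_bot2_mem {c lambda gamma : K} {W : w_fields A} :
  (2%:R : K) \is a GRing.unit -> gamma \is a GRing.unit ->
  fH W \in subvs_pred B -> fL W \in subvs_pred B ->
  w_Lplus c lambda gamma W \in subvs_pred B
    \/ w_Lminus c lambda gamma W \in subvs_pred B ->
  wb W 2 \in subvs_pred B.
Proof.
move=> u2 ug BH BL BLpm; have BT : w_T c W \in subvs_pred B.
  by rewrite rpredB ?rpredZ //; apply: subvs_nprod.
have BD : w_D c lambda gamma W \in subvs_pred B.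
  case: BLpm => BLpm.
    have -> : w_D c lambda gamma W =
        2%:R^-1 *: w_T c W - w_Lplus c lambda gamma W by rewrite subKr.
    by rewrite rpredB ?rpredZ.
  have -> : w_D c lambda gamma W =
      w_Lminus c lambda gamma W - 2%:R^-1 *: w_T c W by rewrite addrC addKr.
  by rewrite rpredB ?rpredZ.
(* The definition of [w_D] is solved for [W^{2,bot}]: [gamma / 2] inverts its coefficient
   [2 / gamma], with no division by [lambda]. *)
have -> : wb W 2 = (gamma / 2%:R) *:
    ((lambda / (2%:R * gamma)) *: w_T c W - w_D c lambda gamma W).
  by rewrite /w_D subKr scalerA mulrA divrK // divrr // scale1r.
by rewrite rpredZ // rpredB ?rpredZ.
Qed.

End GeneratorsInSubalgebra.

(** The defining relations hold in [A] while [B] lies in [A'], so each relation is pushed through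
    [f] before closure of [B] applies. *)
Lemma w_gen_image_mem {K K' : comUnitRingType} {j : {rmorphism K -> K'}}
    {A : vsalgType K} {A' : vsalgType K'} {f : A -> A'} {c lambda omega : K}
    {W : w_fields A} {B : subvsalg A'} :
  va_morphism j f -> is_w_n2_infty c lambda omega W ->
  (forall i, f (n2_gen W i) \in subvs_pred B) -> f (wb W 2) \in subvs_pred B ->
  forall x, f (w_gen W x) \in subvs_pred B.
Proof.
move=> fM hW BN Bb2; have fP := va_morph_nprod fM.
have BGp : f (fGp W) \in subvs_pred B := BN (@Ordinal 4 1 isT).
have BGm : f (fGm W) \in subvs_pred B := BN (@Ordinal 4 2 isT).
have Bt M : (2 <= M)%N -> f (wb W M) \in subvs_pred B ->
    f (wt W M) \in subvs_pred B.
  move=> M2 Bb; rewrite (w_topE hW M2) (va_morphB fM) (va_morphZ fM).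
  rewrite (va_morph_translation fM) !fP.
  by rewrite rpredB ?rpredZ ?subvs_translation ?subvs_nprod.
have Bb M : (2 <= M)%N -> f (wb W M) \in subvs_pred B.
  (* The induction starts at 2 with the hypothesis on [W^{2,bot}]; [Bt] at 2 supplies the raising
     field [W^{2,top}]. *)
  elim: M => // M IHM; rewrite leq_eqVlt => /predU1P[<- //|M2].
  by rewrite -(w_raise hW M2) fP subvs_nprod ?Bt ?IHM.
case=> -[|n] i; first exact: BN.
have M2 : (2 <= n.+2)%N by [].
rewrite /w_gen /=; case: i => -[|[|[|[|//]]]] /= _.
- exact: Bb.
- by rewrite (w_plusE hW M2) (va_morphN fM) fP rpredN subvs_nprod ?Bb.
- by rewrite (w_minusE hW M2) fP subvs_nprod ?Bb.
exact: Bt (Bb _ _).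
Qed.

(** * Minimality of the extension *)

Lemma sub_val_embedding {K : comNzRingType} {A : vsalgType K} (B : subvsalg A) :
  va_embedding (sub_val : sub_va B -> A).
Proof. by split; [split | exact: val_inj]. Qed.

(** Stated for any [V] containing [L_+] or [L_-], so that one argument serves both signs. *)
Lemma w_n2_infty_minimal_extension {K K' : comUnitRingType}
    {j : {rmorphism K -> K'}} {A : vsalgType K} {A' : vsalgType K'} {f : A -> A'}
    {c lambda omega : K} {gamma : K'} {W : w_fields A} (V : subvsalg A') :
  (2%:R : K) \is a GRing.unit -> (3%:R : K) \is a GRing.unit ->
  gamma \is a GRing.unit -> is_w_n2_infty c lambda omega W ->
  scalar_extension j f ->
  let W' := map_w_fields f W in
  w_Lplus (j c) (j lambda) gamma W' \in subvs_pred V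
    \/ w_Lminus (j c) (j lambda) gamma W' \in subvs_pred V ->
  minimal_n2_extension (j c) W' (sub_val : sub_va V -> A').
Proof.
move=> u2 u3 ug hW [fM f_basis] W' VL.
(* The PBW basis of [A] stays a basis after extension of scalars, giving both freeness and spanning
   in [A']. *)
have [free' span'] := f_basis _ _ _ (w_free hW).
have w_genE x : w_gen W' x = f (w_gen W x).
  by case: x => -[|n] [[|[|[|[|//]]]] ?].
have monE s : pbw_monomial (w_gen W') s = f (pbw_monomial (w_gen W) s).
  rewrite (va_morph_pbw_monomial fM); elim: s => //= x s ->.
  by rewrite w_genE.
split; first split.
- apply: (va_morph_n2_superconformal fM) (w_n2 hW) => //.
    exact: va_morph_spanning span'.
  apply: (@w_gen_free_n2_gen _ _ W').
  apply: (free_on_comp id) free' => //; exact: inj_id.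
- exact: sub_val_embedding.
move=> B NB g NBE _ gE.
have Bsub x : sub_val x \in subvs_pred B := valP x.
have BN i : n2_gen W' i \in subvs_pred B.
  by rewrite -NBE; case: i => -[|[|[|[|//]]]] lti; apply: Bsub.
(* The inclusion of [V] factors through [B] via [g], so [V] lies in [B] as a subset of [A']. *)
have VB v : v \in subvs_pred V -> v \in subvs_pred B.
  by move=> Vv; have := Bsub (g (exist _ v Vv)); rewrite gE.
have Bb2 : f (wb W 2) \in subvs_pred B.
  apply: (w_bot2_mem (c := j c) (lambda := j lambda) (W := W') _ ug).
  - by rewrite -(rmorph_nat j) rmorph_unit.
  - exact: BN (@Ordinal 4 0 isT).
  - exact: BN (@Ordinal 4 3 isT).
  by case: VL => /VB; [left | right].
apply: (w_generators_mem_full B (W := W')) => [v|x].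
  have [s [k [Ds ->]]] := span' v; exists s, k; split=> //.
  by apply: eq_bigr => i _; rewrite monE.
rewrite w_genE; apply: (w_gen_image_mem fM hW) => // i.
by have := BN i; case: i => -[|[|[|[|//]]]].
Qed.

Theorem corollary7p22 (Re : realType)
  (R : comUnitRingType) (iota : {rmorphism complex_poly2 Re -> R})
  (hR : is_localization
    [:: var_c Re; var_c Re - 1; var_c Re + 3%:R] iota)
  (omega : R) (homega : omega \is a GRing.unit)
  (A : vsalgType R) (W : w_fields A)
  (hW : is_w_n2_infty (iota (var_c Re)) (iota (var_lambda Re)) omega W)
  (R' : comUnitRingType) (j : {rmorphism R -> R'}) (gamma : R')
  (hR' : is_sqrt_extension j
    (iota (var_lambda Re) ^+ 2 + 32%:R * omega / (iota (var_c Re) - 1)) gamma)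
  (A' : vsalgType R') (f : A -> A') (hA' : scalar_extension j f) :
  let c := j (iota (var_c Re)) in
  let lambda := j (iota (var_lambda Re)) in
  let W' := map_w_fields f W in
  let Lp := w_Lplus c lambda gamma W' in
  let Lm := w_Lminus c lambda gamma W' in
  (forall up : A', weight3_generator (fH W') Lp Lm up ->
    minimal_n2_extension c W'
      (sub_val : sub_va (w_infty_sub Lp up) -> A')) /\
  (forall um : A', weight3_generator (fH W') Lm Lp um ->
    minimal_n2_extension c W'
      (sub_val : sub_va (w_infty_sub Lm um) -> A')).
Proof.
move=> c lambda W' Lp Lm.
have u2 : (2%:R : R) \is a GRing.unit by exact: (natr_unit_complex_poly2 iota).
have u3 : (3%:R : R) \is a GRing.unit by exact: (natr_unit_complex_poly2 iota).
(* [gamma] is invertible because the quadratic extension is localized at it. *)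
have [_ ug _ _] := hR'.
have mem_L (L w : A') : L \in subvs_pred (w_infty_sub L w).
  by apply/gen_predP => B; apply; left.
by split=> w _; apply: (w_n2_infty_minimal_extension _ u2 u3 ug hW hA');
  [left | right]; apply: mem_L.
Qed.
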